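(* Let $N\ge 1$ be an integer, $T>0$, $\alpha\in(0,1)$, $\sigma>0$, $\nu,\mu\in\mathbb{R}$ with $\mu>\nu$, and $\rho_1,\dots,\rho_N\in\mathbb{R}$. Assume that either $$\gamma\in(0,1)\quad\text{and}\quad \max_{i=1,\dots,N}\rho_i\le\alpha\Big(\nu+\frac{(\mu-\nu)^2}{2\gamma\sigma^2}\Big),$$ or $$\gamma\in[1-\alpha,1).$$ Let $(\theta_1,\dots,\theta_N)$ be the unique positive solution on $[0,T]$ of $$ \begin{cases} \dot{\theta}_i(t)+(1-\gamma)\theta_i(t)\Big[\nu+\frac{(\mu-\nu)^2}{2\gamma\sigma^2}-\Big(\sum_{j=1}^N\theta_j(t)\Big)^{\frac{1}{\alpha-1}}\sum_{k=1}^N\theta_k(t)^{\frac{1-\gamma-\alpha}{(1-\alpha)(1-\gamma)}}\Big]\\ \quad-(1-\gamma)\rho_i\alpha^{-1}\theta_i(t)+\alpha^{-1}(1-\gamma)\theta_i(t)^{\frac{1-\gamma-\alpha}{(1-\alpha)(1-\gamma)}}\Big(\sum_{j=1}^N\theta_j(t)\Big)^{\frac{\alpha}{\alpha-1}}=0,\\ \theta_i(T)=1,\qquad i=1,\dots,N, \end{cases} $$ and let the equilibrium consumption strategies be $$\bar c_i(t)=\Big(\sum_{j=1}^N\theta_j(t)\Big)^{\frac{1}{\alpha-1}}\theta_i(t)^{\frac{1-\gamma-\alpha}{(1-\alpha)(1-\gamma)}},\qquad t\in[0,T],\ i=1,\dots,N.$$ Then for any $i_0,j_0\in\{1,\dots,N\}$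 with $\rho_{j_0}\ge\rho_{i_0}\ge0$: if $\gamma\in(0,1-\alpha]$ then $\bar c_{i_0}(t)\ge\bar c_{j_0}(t)$ for all $t\in[0,T]$; and if $\gamma\in[1-\alpha,1)$ then $\bar c_{i_0}(t)\le\bar c_{j_0}(t)$ for all $t\in[0,T]$.
   Context: A positive solution of the ODE system is a solution on $[0,T]$ with $\theta_i(t)>0$ for all $t\in[0,T]$ and all $i$; under the stated assumptions on the coefficients such a solution exists and is unique. Here $\rho_i$ is the discount rate of agent $i$, $\gamma$ the risk aversion coefficient and $(1-\alpha)^{-1}$ the elasticity of intertemporal substitution. *)

(* Defs.v *)
From mathcomp Require Import all_boot all_order all_algebra.
From mathcomp Require Import all_classical all_reals all_analysis.

Set Implicit Arguments.
Unset Strict Implicit.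
Unset Printing Implicit Defensive.

Import Order.TTheory GRing.Theory Num.Theory.
Import numFieldNormedType.Exports.

Local Open Scope classical_set_scope.
Local Open Scope ring_scope.

(* The difference quotient only sees points of A: for A = `[0, T] this is the
   usual derivative at interior points and the one-sided one at 0 and T. *)
Definition is_derive_within (R : realType) (A : set R) (f : R -> R) (t d : R) :
    Prop :=
  (f s - f t) / (s - t) @[s --> within A t^'] --> d.

Section Equilibrium.
Variables (R : realType) (N : nat).
Variables (alpha gamma nu mu sigma : R) (rho : 'I_N -> R).
Implicit Types (theta : 'I_N -> R -> R) (i : 'I_N) (t T : R).

Definition merton_const : R :=
  nu + (mu - nu) ^+ 2 / (2 * gamma * sigma ^+ 2).

Definition theta_exponent : R :=
  (1 - gamma - alpha) / ((1 - alpha) * (1 - gamma)).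

Definition consumption theta i t : R :=
  (\sum_(j < N) theta j t) `^ (alpha - 1)^-1 * theta i t `^ theta_exponent.

(* The terms of the i-th equation other than the derivative of theta i. *)
Definition ode_rest theta i t : R :=
  (1 - gamma) * theta i t *
    (merton_const - (\sum_(j < N) theta j t) `^ (alpha - 1)^-1 *
                    \sum_(k < N) theta k t `^ theta_exponent)
  - (1 - gamma) * rho i * alpha^-1 * theta i t
  + alpha^-1 * (1 - gamma) * theta i t `^ theta_exponent *
    (\sum_(j < N) theta j t) `^ (alpha / (alpha - 1)).

Definition positive_solution T theta : Prop :=
  [/\ forall i t, t \in `[0, T] -> 0 < theta i t,
      forall i t, t \in `[0, T] ->
        exists2 d : R, is_derive_within `[0, T] (theta i) t d &
                       d + ode_rest theta i t = 0
    & forall i, theta i T = 1].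

End Equilibrium.

(* Main.v *)
Require Import Defs.
From mathcomp Require Import all_boot all_order all_algebra.
From mathcomp Require Import all_classical all_reals all_analysis.
From mathcomp Require Import ring lra.

Set Implicit Arguments.
Unset Strict Implicit.
Unset Printing Implicit Defensive.

Import Order.TTheory GRing.Theory Num.Theory.
Import numFieldNormedType.Exports.

Local Open Scope classical_set_scope.
Local Open Scope ring_scope.

(** Let [p] be the exponent of [theta_i] in the consumption, so that [p < 1],
    and let [S] be the sum of the [theta_j].  The coefficients of the system that
    depend on the agent are the discount rates.  The less impatient agent has
    the larger [theta], and raising to the power [p], whose sign is that of
    [1 - gamma - alpha], turns this into the two assertions about the
    consumptions, which share the factor [S ^ (1 / (alpha - 1))].

    To compare, let [m] be the minimum of [theta_i0 / theta_j0] on [[0, T]],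
    attained at [t], and suppose that [m < 1].  Then [t < T], since the ratio is
    [1] at [T].  As [theta_i0 - m * theta_j0] is nonnegative and vanishes at
    [t], its right derivative there is nonnegative.  The equations give its
    value, in which every term that is linear in [theta] with a common
    coefficient cancels:
      [(1 - gamma) / alpha * ((rho_i0 - rho_j0) * theta_i0
          - (m ^ p - m) * theta_j0 ^ p * S ^ (alpha / (alpha - 1)))].
    Now [rho_i0 <= rho_j0], and [m < m ^ p] because [m < 1] and [p < 1], so the
    value is negative, a contradiction.  Hence [theta_j0 <= theta_i0]
    ([theta_le]).  The analytic half of this is
    [derive_within_comparison], the algebraic half is
    [ode_rest_scaled_lt]. *)

Section DeriveWithin.
Variable R : realType.
Implicit Types (f g df dg : R -> R) (a b c d t : R).

Lemma is_derive_within_continuous (A : set R) f t d :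
  is_derive_within A f t d -> f s @[s --> within A (nbhs t)] --> f t.
Proof.
move=> fd.
have idt : (s - t) @[s --> within A t^'] --> (0 : R).
  rewrite -(subrr t); apply: cvgB; last exact: cvg_cst.
  by move=> P Pt; apply: (@filterS _ (nbhs t)) Pt => s Ps _ _.
have : (f s - f t) / (s - t) * (s - t) + f t @[s --> within A t^'] --> f t.
  rewrite -[X in _ --> X]add0r -(mulr0 d).
  by apply: cvgD; [exact: cvgM|exact: cvg_cst].
move=> lim P Pft; apply: (@filterS _ (nbhs t)) (lim _ Pft) => s /= H As.
(* At [s = t] the difference quotient says nothing, but [f t] is in every
   neighbourhood of itself. *)
have [->|st] := eqVneq s t; first exact: nbhs_singleton.
by have := H st As; rewrite divfK ?subr_eq0// subrK.
Qed.

Lemma is_derive_within_scaleB (A : set R) f g t d c e :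
  is_derive_within A f t d -> is_derive_within A g t e ->
  is_derive_within A (fun s => f s - c * g s) t (d - c * e).
Proof.
move=> fd ge; rewrite /is_derive_within.
have -> : (fun s => (f s - c * g s - (f t - c * g t)) / (s - t)) =
    (fun s => (f s - f t) / (s - t) - c * ((g s - g t) / (s - t))).
  by apply/funext => s; ring.
by apply: cvgB => //; apply: cvgM => //; exact: cvg_cst.
Qed.

(** Only points to the right of [t] matter, so this covers an endpoint minimum
    at [a]; at [b] it would fail. *)
Lemma is_derive_within_ge0 a b f t d :
  a <= t < b -> is_derive_within `[a, b] f t d ->
  (forall s, s \in `[a, b] -> f t <= f s) -> 0 <= d.
Proof.
move=> /andP[at_ tb] fd fmin.
have fr : (f s - f t) / (s - t) @[s --> t^'+] --> d.
  move=> P /fd H; have tbn : \forall s \near nbhs t, s < b by exact: lt_nbhsl.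
  apply: (@filterS2 _ (nbhs t)) H tbn => s /= H sb ts; apply: H.
    by rewrite gt_eqF.
  by rewrite /= in_itv/= (le_trans at_ (ltW ts)) ltW.
rewrite -(cvg_lim _ fr)//; apply: limr_ge; first by apply/cvg_ex; exists d.
near=> s; rewrite divr_ge0// subr_ge0; last first.
  by apply: ltW; near: s; exact: nbhs_right_gt.
apply: fmin; rewrite in_itv/=; apply/andP; split; last first.
  by apply: ltW; near: s; exact: nbhs_right_lt.
by apply: (le_trans at_); apply: ltW; near: s; exact: nbhs_right_gt.
Unshelve. all: by end_near. Qed.

(** A backward comparison principle.  The condition on derivatives is only
    required at a point where the graph of [f] touches that of [m * g] with
    [m < 1]: if [f < g] somewhere then the minimum [m] of [f / g] is less than
    [1], and [m * g] touches [f] from below at a point other than [b], where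
    [f - m * g] cannot have a negative derivative. *)
Lemma derive_within_comparison a b f g df dg :
  a <= b ->
  (forall t, t \in `[a, b] -> 0 < f t) ->
  (forall t, t \in `[a, b] -> 0 < g t) ->
  (forall t, t \in `[a, b] -> is_derive_within `[a, b] f t (df t)) ->
  (forall t, t \in `[a, b] -> is_derive_within `[a, b] g t (dg t)) ->
  g b <= f b ->
  (forall t m, t \in `[a, b] -> 0 < m < 1 -> f t = m * g t ->
     df t < m * dg t) ->
  forall t, t \in `[a, b] -> g t <= f t.
Proof.
move=> ab f0 g0 fdf gdg gfb contact.
have cont : {within `[a, b], continuous (fun s => f s / g s)}.
  apply/subspace_continuousP => t /= tab.
  apply: cvgM; first exact: is_derive_within_continuous (fdf t tab).
  apply: cvgV; first by rewrite gt_eqF ?g0.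
  exact: is_derive_within_continuous (gdg t tab).
have [c cab cmin] := EVT_min ab cont.
have [m1|m1] := leP 1 (f c / g c).
  move=> t tab; have := le_trans m1 (cmin t tab).
  by rewrite ler_pdivlMr ?g0// mul1r.
have cb : c < b.
  move: (cab); rewrite in_itv/= => /andP[_]; rewrite le_eqVlt => /predU1P[cb|//].
  move: m1; rewrite -cb in gfb.
  by rewrite ltr_pdivrMr ?g0// mul1r ltNge gfb.
have fcE : f c = f c / g c * g c by rewrite divfK// gt_eqF ?g0.
set m := f c / g c in cmin m1 fcE.
have := contact c m cab; rewrite m1 divr_gt0 ?f0 ?g0// => /(_ isT fcE).
rewrite -subr_lt0 ltNge => /negP[].
have hB := is_derive_within_scaleB (c := m) (fdf c cab) (gdg c cab).
apply: is_derive_within_ge0 hB _.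
  by move: cab; rewrite in_itv/= cb => /andP[->].
move=> s sab; rewrite -fcE subrr subr_ge0 -ler_pdivlMr ?g0//.
exact: cmin.
Qed.

End DeriveWithin.

Lemma lt1_powR_gt (R : realType) (m p : R) : 0 < m < 1 -> p < 1 -> m < m `^ p.
Proof.
move=> /andP[m0 m1] p1.
have : m `^ (1 - p) < 1.
  have : m `^ (1 - p) < 1 `^ (1 - p).
    by rewrite gt0_ltr_powR ?nnegrE ?subr_gt0// ltW.
  by rewrite powR1.
rewrite -(ltr_pM2l (powR_gt0 p m0)) mulr1 -powRD; last first.
  by rewrite (gt_eqF m0) implybT.
by rewrite addrC subrK powRr1// ltW.
Qed.

Lemma le0_ger_powR (R : realType) (p x y : R) :
  p <= 0 -> 0 < x -> x <= y -> y `^ p <= x `^ p.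
Proof.
move=> p0 x0 xy; have y0 := lt_le_trans x0 xy.
rewrite -(opprK p) !(powRN _ (- p)) lef_pV2 ?posrE ?powR_gt0//.
by rewrite ge0_ler_powR ?nnegrE ?oppr_ge0// ltW.
Qed.

Section Agents.
Variables (R : realType) (N : nat).
Variables (alpha gamma nu mu sigma : R) (rho : 'I_N -> R).
Hypotheses (halpha : 0 < alpha < 1) (hgamma : 0 < gamma < 1).
Implicit Types (theta : 'I_N -> R -> R).

Let p := theta_exponent alpha gamma.
Let rest := ode_rest alpha gamma nu mu sigma rho.

Lemma theta_exponent_lt1 : p < 1.
Proof.
move: halpha hgamma => /andP[a0 a1] /andP[g0 g1].
rewrite /p /theta_exponent ltr_pdivrMr; last by rewrite mulr_gt0// subr_gt0.
by rewrite mul1r -subr_gt0; have := mulr_gt0 a0 g0; nra.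
Qed.

Lemma theta_exponent_ge0 : gamma <= 1 - alpha -> 0 <= p.
Proof.
move: halpha hgamma => /andP[a0 a1] /andP[g0 g1] ga.
by rewrite divr_ge0 ?mulr_ge0//; lra.
Qed.

Lemma theta_exponent_le0 : 1 - alpha <= gamma -> p <= 0.
Proof.
move: halpha hgamma => /andP[a0 a1] /andP[g0 g1] ga.
by rewrite ler_pdivrMr ?mul0r ?mulr_gt0//; lra.
Qed.

(** The [merton_const] and consumption terms have the same coefficient for every
    agent, so they cancel when [theta i t = m * theta j t].  What remains is a
    discount term with the sign of [rho i - rho j] and a power term with that of
    [m - m `^ p], which is strictly negative. *)
Lemma ode_rest_scaled_lt theta (i j : 'I_N) t m :
  (forall k, 0 < theta k t) -> rho i <= rho j -> 0 < m < 1 ->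
  theta i t = m * theta j t ->
  - rest theta i t < m * - rest theta j t.
Proof.
move=> th0 rij m01 E; move: (halpha) (hgamma) => /andP[a0 a1] /andP[g0 g1].
have /andP[m0 m1] := m01.
rewrite /rest /ode_rest -/p.
have Ep : theta i t `^ p = m `^ p * theta j t `^ p.
  by rewrite E powRM// ltW.
have mp := lt1_powR_gt m01 theta_exponent_lt1.
rewrite Ep E -subr_gt0.
set S := \sum_(k < N) theta k t.
set K := merton_const _ _ _ _ - _.
set B := S `^ (alpha / (alpha - 1)).
set X := theta j t `^ p.
have X0 : 0 < X by exact: powR_gt0.
have S0 : 0 < S.
  rewrite /S (bigD1 j)//= ltr_pwDl//.
  by apply: sumr_ge0 => k _; exact: ltW.
have B0 : 0 < B by exact: powR_gt0.
have -> : m * - ((1 - gamma) * theta j t * K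
      - (1 - gamma) * rho j * alpha^-1 * theta j t
      + alpha^-1 * (1 - gamma) * X * B)
    - - ((1 - gamma) * (m * theta j t) * K
      - (1 - gamma) * rho i * alpha^-1 * (m * theta j t)
      + alpha^-1 * (1 - gamma) * (m `^ p * X) * B)
  = alpha^-1 * (1 - gamma) *
    ((rho j - rho i) * (m * theta j t) + (m `^ p - m) * (X * B)) by ring.
apply: mulr_gt0; first by rewrite mulr_gt0 ?invr_gt0 ?subr_gt0.
apply: ltr_wpDl; last by rewrite !mulr_gt0 ?subr_gt0.
by rewrite mulr_ge0 ?subr_ge0// ltW// mulr_gt0.
Qed.

Lemma theta_le (T : R) theta (i j : 'I_N) :
  0 < T -> positive_solution alpha gamma nu mu sigma rho T theta ->
  rho i <= rho j ->
  forall t, t \in `[0, T] -> theta j t <= theta i t.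
Proof.
move=> T0 [th0 ode thT] rij.
have der k t : t \in `[0, T] ->
    is_derive_within `[0, T] (theta k) t (- rest theta k t).
  move=> tT; have [d dd /eqP] := ode k t tT.
  by rewrite addr_eq0 => /eqP <-.
apply: (derive_within_comparison (ltW T0) (th0 i) (th0 j) (der i) (der j)).
  by rewrite !thT.
move=> t m tT m01 E.
by apply: ode_rest_scaled_lt => // k; exact: th0.
Qed.

End Agents.

Theorem proposition5p1 (R : realType) (N : nat) (hN : (0 < N)%N)
    (T alpha sigma nu mu gamma : R) (rho : 'I_N -> R)
    (theta : 'I_N -> R -> R)
    (hT : 0 < T) (halpha : 0 < alpha < 1) (hsigma : 0 < sigma)
    (hmu : nu < mu)
    (hgamma :
      (0 < gamma < 1 /\
       \big[Num.max/rho (Ordinal hN)]_(i < N) rho i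
         <= alpha * (nu + (mu - nu) ^+ 2 / (2 * gamma * sigma ^+ 2)))
      \/ (1 - alpha <= gamma < 1))
    (htheta : positive_solution alpha gamma nu mu sigma rho T theta)
    (i0 j0 : 'I_N) (hrho : 0 <= rho i0 <= rho j0) :
  (0 < gamma <= 1 - alpha ->
     forall t : R, t \in `[0, T] ->
       consumption alpha gamma theta j0 t <= consumption alpha gamma theta i0 t)
  /\
  (1 - alpha <= gamma < 1 ->
     forall t : R, t \in `[0, T] ->
       consumption alpha gamma theta i0 t <= consumption alpha gamma theta j0 t).
Proof.
have /andP[_ rij] := hrho; have [th0 _ _] := htheta.
have /andP[a0 a1] := halpha.
split=> /andP[g0 g1] t tT; apply: ler_wpM2l; rewrite ?powR_ge0//.
- have g01 : 0 < gamma < 1 by rewrite g0/=; lra.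
  have thij := theta_le halpha g01 hT htheta rij tT.
  by rewrite ge0_ler_powR ?theta_exponent_ge0 ?nnegrE// ltW// th0.
- have g01 : 0 < gamma < 1 by rewrite g1 andbT; lra.
  have thij := theta_le halpha g01 hT htheta rij tT.
  by rewrite le0_ger_powR ?theta_exponent_le0 ?th0.
Qed.
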